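(* Let $G=(VG,EG)$ be a finite undirected graph, $T\subseteq VG$ a set of terminals, $c\colon VG\to\mathbb{Z}_+$, $a\colon VG\to\mathbb{Z}_+$ and $\lambda\in\mathbb{Z}_+$. Consider the linear program: minimize $\sum_{v\in VG}c(v)l(v)$ over $l\colon VG\to\mathbb{Q}_+$ subject to $l(VP)\ge\lambda-a(VP)$ for every $T$-path $P$. This program has an optimal solution $l$ that is half-integer, i.e. $l(v)\in\frac12\mathbb{Z}_+$ for all $v\in VG$.
   Context: A path is an edge-simple walk; $VP$ is its node set and for $w\colon VG\to\mathbb{Q}$, $w(VP)=\sum_{v\in VP}w(v)$. Nodes of $VG-T$ are inner. A $T$-path is a path whose two ends are distinct terminals and whose other nodes are inner. (This program is the LP dual of maximizing $\lambda\sum_P F(P)-\sum_P a(VP)F(P)$ over $F\colon\{T\text{-paths}\}\to\mathbb{Q}_+$ with $\sum_{P\ni v}F(P)\le c(v)$ for all $v$.) *)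

(* Defs.v *)
From mathcomp Require Import all_boot all_order all_algebra.

Set Implicit Arguments.
Unset Strict Implicit.
Unset Printing Implicit Defensive.

Import Order.TTheory GRing.Theory Num.Theory.

Local Open Scope ring_scope.

(* Parallel edges and loops are allowed: [ends] need not be injective, and a
   loop at x has [ends e = [set x]]. Simple graphs are a special case. *)
Record graph := Graph {
  VG : finType;
  EG : finType;
  ends : EG -> {set VG};
  card_ends : forall e : EG, (0 < #|ends e| <= 2)%N }.

Section Paths.
Variable G : graph.
Implicit Types (x : VG G) (s : seq (EG G * VG G)) (T : {set VG G}).

(* The walk x, e1, x1, ..., ek, xk is encoded by its first node x and the
   sequence s = [:: (e1, x1); ...; (ek, xk)]. *)
Fixpoint walk x s : bool :=
  if s is (e, y) :: s' then (ends e == [set x; y]) && walk y s' else true.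

Definition is_path x s : bool := walk x s && uniq (unzip1 s).

Definition last_node x s : VG G := last x (unzip2 s).

Definition VP x s : {set VG G} := [set v in x :: unzip2 s].

Definition T_path T x s : bool :=
  [&& is_path x s, x \in T, last_node x s \in T, x != last_node x s
    & [forall v in VP x s :\: [set x; last_node x s], v \notin T]].

End Paths.

Definition weight (V : finType) (w : V -> rat) (A : {set V}) : rat :=
  \sum_(v in A) w v.

Definition natw (V : finType) (w : V -> nat) : V -> rat := fun v => (w v)%:R.

Definition feasible (G : graph) (T : {set VG G}) (a : VG G -> nat)
    (lambda : nat) (l : VG G -> rat) : Prop :=
  (forall v, 0 <= l v) /\
  (forall x s, T_path T x s ->
     lambda%:R - weight (natw a) (VP x s) <= weight l (VP x s)).

Definition objective (G : graph) (c : VG G -> nat) (l : VG G -> rat) : rat :=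
  \sum_v (c v)%:R * l v.

Definition optimal (G : graph) (T : {set VG G}) (c a : VG G -> nat)
    (lambda : nat) (l : VG G -> rat) : Prop :=
  feasible T a lambda l /\
  (forall l', feasible T a lambda l' -> objective c l <= objective c l').

Definition half_integer (V : finType) (l : V -> rat) : Prop :=
  forall v, exists k : nat, l v = k%:R / 2%:R.

(* Main.v *)
(* Put w = l + a, so that the constraints read w >= a and w(VP) >= lambda.  Let
   M v be the least weight of a connected node set joining v to a terminal,
   v included, and m v = M v - w v.  For a feasible w, choose theta at random in
   (0, 1) and replace w v by r (M v) - r (m v), where r rounds to half-integers,
   is monotone and odd, commutes with integer translations, and has mean the
   identity.  Translation by a v preserves w >= a, and oddness together with
   M x + M y >= lambda on each edge between two Voronoi regions preserves
   w(VP) >= lambda.  The mean cost is the cost of w, so some theta gives a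
   half-integer feasible point that is no more expensive.  Half-integer costs
   are well-ordered, so a cheapest half-integer feasible point exists, and it is
   optimal.  Scaling by a common denominator N of w makes everything integral,
   and theta = (k + 1/2)/N with k < N suffices. *)
Require Import Defs.
From mathcomp Require Import all_boot all_order all_algebra.
From mathcomp Require Import zify ring lra.
From Stdlib Require Import Classical.

Set Implicit Arguments.
Unset Strict Implicit.
Unset Printing Implicit Defensive.

Import Order.TTheory GRing.Theory Num.Theory.

(** * Connectivity inside a node set and extraction of T-paths *)

Section Connection.
Variable G : graph.
Implicit Types (x y t : VG G) (A B T : {set VG G}) (p : seq (VG G)).

Definition adj x y : bool := [exists e : EG G, ends e == [set x; y]].

Definition adj_in A x y : bool := [&& x \in A, y \in A & adj x y].

(** [connect] is reflexive even outside [A], hence the separate membership test. *)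
Definition linked A x y : bool := (x \in A) && connect (adj_in A) x y.

Lemma adj_sym : symmetric adj.
Proof. by move=> x y; apply: eq_existsb => e; rewrite setUC. Qed.

Lemma linked_sym A x y : linked A x y = linked A y x.
Proof.
have adj_inC : connect_sym (adj_in A).
  by apply: sym_connect_sym => u v; rewrite /adj_in adj_sym andbCA.
suff one u v : linked A u v -> linked A v u by apply/idP/idP; apply: one.
case/andP=> uA /connectP[p uvp ->]; rewrite /linked adj_inC.
apply/andP; split; last by apply/connectP; exists p.
elim: p u uA uvp => //= w p IHp u uA /andP[/and3P[_ wA _]].
exact: IHp.
Qed.

Lemma linked_self A x : x \in A -> linked A x x.
Proof. by move=> xA; rewrite /linked xA connect0. Qed.

Lemma linked_trans A x y z : linked A x y -> linked A y z -> linked A x z.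
Proof.
by case/andP=> xA xy /andP[_ yz]; rewrite /linked xA (connect_trans xy yz).
Qed.

Lemma linkedS A B x y : A \subset B -> linked A x y -> linked B x y.
Proof.
move=> /subsetP sAB /andP[xA xy]; rewrite /linked sAB //=.
apply: connect_sub xy => u v /and3P[uA vA uv]; apply: connect1.
by rewrite /adj_in !sAB.
Qed.

Lemma linked_mem A x y : linked A x y -> y \in A.
Proof. by rewrite linked_sym => /andP[]. Qed.

Lemma linked_adj A x y z : linked A x y -> z \in A -> adj y z -> linked A x z.
Proof.
move=> xy zA yz; apply: (linked_trans xy).
by rewrite /linked (linked_mem xy) connect1 // /adj_in (linked_mem xy) zA.
Qed.

Lemma walk_of_path x p : path adj x p -> exists2 s, unzip2 s = p & walk x s.
Proof.
elim: p x => [|y p IHp] x /=; first by exists [::].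
case/andP=> /existsP[e exy] /IHp[s <- ys].
by exists ((e, y) :: s); rewrite //= exy.
Qed.

Lemma path_of_walk x (s : seq (EG G * VG G)) :
  walk x s -> path adj x (unzip2 s).
Proof.
elim: s x => //= -[e y] s IHs x /andP[exy /IHs ->]; rewrite andbT.
by apply/existsP; exists e.
Qed.

Lemma walk_ends_mem x (s : seq (EG G * VG G)) e z :
  walk x s -> e \in unzip1 s -> z \in ends e -> z \in x :: unzip2 s.
Proof.
elim: s x => //= -[e' y] s IHs x /andP[/eqP exy ys] /=.
rewrite inE => /orP[/eqP-> |es ze]; last by rewrite inE (IHs y) ?orbT.
by rewrite exy !inE => /orP[] ->; rewrite ?orbT.
Qed.

(** If the first edge were used again, its end [x] would recur among the later nodes. *)
Lemma walk_uniq_edges x (s : seq (EG G * VG G)) :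
  walk x s -> uniq (x :: unzip2 s) -> uniq (unzip1 s).
Proof.
elim: s x => // -[e y] s IHs x /= /andP[/eqP exy ys] /andP[xs us].
rewrite (IHs y) // andbT; apply/negP => es.
by case/negP: xs; apply: (walk_ends_mem ys es); rewrite exy !inE eqxx.
Qed.

Lemma linked_walk x (s : seq (EG G * VG G)) :
  walk x s -> linked (VP x s) x (last_node x s).
Proof.
move=> xs; rewrite /linked inE mem_head /=; apply/connectP.
exists (unzip2 s) => //; have := path_of_walk xs; rewrite /VP.
have: {subset x :: unzip2 s <= [set v in x :: unzip2 s]}.
  by move=> v; rewrite in_set.
move: [set v in _] => A; elim: (unzip2 s) {xs}x => //= y p IHp x sA /andP[xy yp].
rewrite /adj_in xy IHp ?sA ?inE ?eqxx ?orbT // => v vyp.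
by rewrite sA // inE vyp orbT.
Qed.

(** Shorten a connection inside [A] to a simple path and cut it at its first terminal after [x]. *)
Lemma T_path_linked T A x y : x \in T -> y \in T -> x != y -> linked A x y ->
  exists z s, [/\ T_path T z s, uniq (z :: unzip2 s) & VP z s \subset A].
Proof.
move=> xT yT neq_xy /andP[xA /connectP[p0 xp0 yE]].
case/shortenP: xp0 yE => p xp up _ yE {p0}.
have Tp : has (mem T) p.
  apply/hasP; exists y => //; case: p yE {xp up} => [|u p] yE.
    by rewrite yE /= eqxx in neq_xy.
  by rewrite yE last_cons mem_last.
move: up xp; case/split_find: Tp => {p yE}u q r; rewrite [mem T u]/= => uT qT.
rewrite -cat_cons cat_uniq cat_path => /andP[up _] /andP[xp _].
have/walk_of_path[s sE xs] : path adj x (rcons q u).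
  by apply: sub_path xp => v w /and3P[].
have sA : VP x s \subset A.
  apply/subsetP => v; rewrite inE sE.
  elim: (rcons q u) x xA xp {xs up xT neq_xy} => [|w p' IHp] x xA /=.
    by rewrite inE => _ /eqP->.
  case/andP=> /and3P[_ wA _] wp; rewrite inE => /orP[/eqP-> //|].
  exact: IHp wA wp.
exists x, s; rewrite sE; split=> //.
have lastE : last_node x s = u by rewrite /last_node sE last_rcons.
rewrite /T_path /is_path xs lastE xT uT /= (walk_uniq_edges xs) ?sE //=.
apply/andP; split.
  by move: up; rewrite /= mem_rcons inE negb_or; case/andP=> /andP[].
apply/forall_inP => v; rewrite !inE sE mem_rcons inE negb_or.
case/andP=> /andP[/negPf-> /negPf->] /= vq.
by apply: contra qT => vT; apply/hasP; exists v.
Qed.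

End Connection.

(** * Odd, monotone rounding to half-integers *)

Section Rounding.
Local Open Scope ring_scope.
Variable N : nat.
Hypothesis N_gt0 : (0 < N)%N.

(* Twice the value at p/N of the rounding whose jumps, each of height 1/2, are
   at the points of theta + Z and -theta + Z with theta = (k + 1/2)/N.  The half
   in theta keeps every p/N off the jumps, which makes the rounding odd. *)
Definition rnd (k : nat) (p : int) : int :=
  ((p - k%:Z - 1) %/ N)%Z + ((p + k%:Z) %/ N)%Z + 1.

Let N0 : 0 < N%:Z. Proof. by []. Qed.

Lemma divz_pos_le (p q : int) : p <= q -> (p %/ N <= q %/ N)%Z.
Proof.
move: (Posz N) N0 => d d0 le_pq; have := lez_floor p (lt0r_neq0 d0).
by have := ltz_ceil q d0; nia.
Qed.

(** Sending [p] to [- p - 1] permutes the blocks of integers from [q * N] to [q * N + N - 1]. *)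
Lemma divz_pos_opp (p : int) : ((- p - 1) %/ N)%Z = - (p %/ N)%Z - 1.
Proof.
move: (Posz N) N0 => d d0.
have := lez_floor p (lt0r_neq0 d0); have := ltz_ceil p d0.
have := lez_floor (- p - 1) (lt0r_neq0 d0); have := ltz_ceil (- p - 1) d0.
nia.
Qed.

Lemma divz_pos_addMr (p n : int) : ((p + n * N) %/ N)%Z = (p %/ N)%Z + n.
Proof. by rewrite addrC divzMDl ?lt0r_neq0 // addrC. Qed.

Lemma rnd_le k (p q : int) : p <= q -> rnd k p <= rnd k q.
Proof.
by move=> le_pq; rewrite /rnd lerD2r lerD // divz_pos_le // !lerD2r.
Qed.

(** Negation swaps the two quotients up to sign and adds -1 to each; the [+ 1] in [rnd] balances
    this. *)
Lemma rndN k (p : int) : rnd k (- p) = - rnd k p.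
Proof.
rewrite /rnd (_ : - p - k%:Z - 1 = - (p + k%:Z) - 1); last by ring.
rewrite (_ : - p + k%:Z = - (p - k%:Z - 1) - 1); last by ring.
by rewrite !divz_pos_opp; ring.
Qed.

Lemma rnd0 k : rnd k 0 = 0.
Proof. have := rndN k 0; rewrite oppr0; move: (rnd k 0) => r; lia. Qed.

Lemma rndDM k (p n : int) : rnd k (p + n * N) = rnd k p + 2 * n.
Proof.
rewrite /rnd 2!(addrAC p (n * N)) (addrAC (p - _) (n * N)) !divz_pos_addMr; lia.
Qed.

(** Monotonicity compares [p] with [n * N - q], whose image is [2 * n - rnd k q] by translation and
    oddness. *)
Lemma rnd_flip k (n p q : int) : n * N <= p + q -> 2 * n <= rnd k p + rnd k q.
Proof.
move=> le_n; have: rnd k (- q + n * N) <= rnd k p by apply: rnd_le; lia.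
rewrite rndDM rndN; lia.
Qed.

Lemma sum_rndS (p : int) :
  \sum_(k < N) rnd k (p + 1) = \sum_(k < N) rnd k p + 2.
Proof.
rewrite [RHS]addrC; apply/eqP; rewrite -subr_eq -sumrB; apply/eqP.
(* The increment of [rnd k] at [p] is [f k.+1 - f k], so the sum telescopes to [f N - f 0], where
   [f N] is 1 - (-1) and [f 0] is 0. *)
pose f k : int := ((p + k%:Z) %/ N)%Z - ((p - k%:Z) %/ N)%Z.
rewrite -(big_mkord xpredT (fun k => rnd k (p + 1) - rnd k p)).
rewrite (eq_bigr (fun k => f k.+1 - f k)) => [|k _].
  rewrite telescope_sumr // /f !addr0 subrr subr0.
  have := divz_pos_addMr p 1; have := divz_pos_addMr p (- 1).
  rewrite mulN1r mul1r; lia.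
rewrite /rnd /f intS (_ : p + 1 - k%:Z - 1 = p - k%:Z); last by ring.
rewrite (_ : p + 1 + k%:Z = p + (1 + k%:Z)); last by ring.
by rewrite (_ : p - (1 + k%:Z) = p - k%:Z - 1); ring.
Qed.

Lemma sum_rndD (p : int) (n : nat) :
  \sum_(k < N) (rnd k (p + n%:Z) - rnd k p) = 2 * n%:Z.
Proof.
rewrite sumrB; elim: n => [|n IHn]; first by rewrite addr0 subrr.
rewrite intS (_ : p + (1 + n%:Z) = p + n%:Z + 1); last by ring.
by rewrite sum_rndS addrAC IHn; ring.
Qed.

End Rounding.

(** * Node-weighted distance to the terminals *)

Section Potential.
Variables (G : graph) (T : {set VG G}) (W : VG G -> nat).
Implicit Types (x y t : VG G) (A B : {set VG G}).

Definition reaches A x : bool := [exists t in T, linked A t x].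

Definition reachable x : bool := reaches setT x.

(* Node sets rather than walks, because l(VP) counts a repeated node once.  For
   an x that is joined to no terminal the value is junk. *)
Definition pot x : nat :=
  \sum_(u in [arg min_(A < setT | reaches A x) \sum_(u in A) W u]) W u.

(** The Voronoi region of [t]; because of ties, regions may overlap. *)
Definition near t x : Prop :=
  t \in T /\ exists2 A, linked A t x & pot x = \sum_(u in A) W u.

Lemma leq_sum_subset A B :
  A \subset B -> \sum_(u in A) W u <= \sum_(u in B) W u.
Proof.
by move=> /setIidPr sAB; rewrite [leqRHS](big_setID A) /= sAB leq_addr.
Qed.

Lemma leq_sum_setU A B :
  \sum_(u in A :|: B) W u <= \sum_(u in A) W u + \sum_(u in B) W u.
Proof.
rewrite (big_setID A) /= setUK setDUl setDv set0U leq_add2l.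
exact: leq_sum_subset (subsetDl _ _).
Qed.

Lemma reachesS A B x : A \subset B -> reaches A x -> reaches B x.
Proof.
move=> sAB /existsP[t /andP[tT tx]]; apply/existsP; exists t.
by rewrite tT (linkedS sAB).
Qed.

Lemma reaches_adj A x y : reaches A x -> adj x y -> reaches (y |: A) y.
Proof.
move=> /existsP[t /andP[tT tx]] xy; apply/existsP; exists t; rewrite tT.
by rewrite (linked_adj (linkedS (subsetUr _ A) tx) _ xy) // setU11.
Qed.

Lemma reachable_T t : t \in T -> reachable t.
Proof.
by move=> tT; apply/existsP; exists t; rewrite tT linked_self ?inE.
Qed.

Lemma reachable_adj x y : reachable x -> adj x y -> reachable y.
Proof. by move=> rx /(reaches_adj rx); rewrite setUT. Qed.

Lemma pot_le A x : reaches A x -> pot x <= \sum_(u in A) W u.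
Proof.
move=> Ax; rewrite /pot; case: arg_minnP => [|B _]; last exact.
exact: reachesS (subsetT A) Ax.
Qed.

Lemma near_ex x : reachable x -> exists t, near t x.
Proof.
rewrite /near /pot => rx; case: arg_minnP => // A /existsP[t /andP[tT tx]] _.
by exists t; split=> //; exists A.
Qed.

Lemma weight_le_pot x : reachable x -> W x <= pot x.
Proof.
case/near_ex=> t [_ [A /linked_mem xA ->]].
by rewrite (big_setD1 x) //= leq_addr.
Qed.

Lemma pot_T t : t \in T -> pot t = W t.
Proof.
move=> tT; apply/eqP; rewrite eqn_leq weight_le_pot ?reachable_T // andbT.
rewrite -(big_set1 addn t W) pot_le //; apply/existsP; exists t.
by rewrite tT linked_self ?set11.
Qed.

Lemma near_T t : t \in T -> near t t.
Proof.
move=> tT; split=> //; exists [set t]; first by rewrite linked_self ?set11.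
by rewrite pot_T // big_set1.
Qed.

Lemma pot_adj x y : reachable x -> adj x y -> pot y <= pot x + W y.
Proof.
move=> /near_ex[t [tT [A tx ->]]] xy.
have /(@reaches_adj A)/(_ xy)/pot_le le_y : reaches A x.
  by apply/existsP; exists t; rewrite tT.
apply: leq_trans le_y (leq_trans (leq_sum_setU _ _) _).
by rewrite big_set1 addnC.
Qed.

Variable L : nat.
Hypothesis le_T_path : forall x s, T_path T x s -> L <= \sum_(u in VP x s) W u.

Lemma le_linked A t t' :
  t \in T -> t' \in T -> t != t' -> linked A t t' -> L <= \sum_(u in A) W u.
Proof.
move=> tT tT' neq_t /(T_path_linked tT tT' neq_t)[z [s [zs _ sA]]].
exact: leq_trans (le_T_path zs) (leq_sum_subset sA).
Qed.

(** The cheapest sets for [x] and [y], joined by the edge, link [t] to [t'], so their union contains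
    a T-path. *)
Lemma near_adj t t' x y :
  near t x -> near t' y -> t != t' -> adj x y -> L <= pot x + pot y.
Proof.
move=> [tT [A tx ->]] [tT' [B ty ->]] neq_t xy.
apply: leq_trans (leq_sum_setU A B); apply: (le_linked tT tT' neq_t).
have := linkedS (subsetUr A B) ty; rewrite linked_sym; apply: linked_trans.
apply: linked_adj xy; first exact: linkedS (subsetUl A B) tx.
by rewrite inE (linked_mem ty) orbT.
Qed.

(** Zero weights can create a tie that puts a terminal into the region of another one. *)
Lemma near_terminal t t' : near t t' -> t' \in T -> t != t' -> L <= pot t'.
Proof. by move=> [tT [A tt' ->]] tT' neq_t; apply: (le_linked tT tT'). Qed.

End Potential.

(** * Feasibility of the rounded weight *)

Section RoundedWeight.
Local Open Scope ring_scope.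
Variables (G : graph) (T : {set VG G}) (W a : VG G -> nat) (N lambda : nat).
Hypothesis N_gt0 : (0 < N)%N.
Hypothesis le_aW : forall v, (a v * N <= W v)%N.
Hypothesis le_T_path :
  forall x s, T_path T x s -> (lambda * N <= \sum_(u in VP x s) W u)%N.

Let M v : int := (pot T W v)%:Z.
Let m v : int := M v - (W v)%:Z.

(** Twice the new weight of [v], since [rnd] counts in halves. *)
Definition rounded (k : nat) (v : VG G) : int :=
  rnd N k (pot T W v)%:Z - rnd N k ((pot T W v)%:Z - (W v)%:Z).

Lemma roundedE k v : rounded k v = rnd N k (M v) - rnd N k (m v).
Proof. by []. Qed.

(** Here [m v + a v * N] is at most [M v]. This holds for any value of [pot], so nodes joined to no
    terminal are covered. *)
Lemma rounded_ge k v : (2 * a v)%:Z <= rounded k v.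
Proof.
have: rnd N k (m v + (a v)%:Z * N) <= rnd N k (M v).
  by apply: rnd_le => //; rewrite /m; have := le_aW v; lia.
by rewrite rndDM // roundedE; lia.
Qed.

Lemma sum_rounded v : \sum_(k < N) rounded k v = 2 * (W v)%:Z.
Proof. by rewrite -(sum_rndD N_gt0 (m v)) /m subrK. Qed.

(** On each edge [m x <= M y], so the bound for [y] absorbs the subtracted [rnd N k (m x)]; at the
    final terminal [m] vanishes. *)
Lemma rounded_path_back k x p : reachable T x -> path (@adj G) x p ->
  last x p \in T -> rnd N k (M x) <= \sum_(v <- x :: p) rounded k v.
Proof.
elim: p x => [|y p IHp] x rx /=.
  move=> _ xT; rewrite big_seq1 /rounded pot_T // subrr rnd0 // subr0.
  by rewrite /M pot_T.
case/andP=> xy yp pT; have ry := reachable_adj rx xy.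
have := IHp y ry yp pT; rewrite (big_cons _ _ x).
have: rnd N k (m x) <= rnd N k (M y).
  apply: rnd_le => //; have := pot_adj W ry (etrans (adj_sym y x) xy).
  by rewrite /m /M; lia.
by rewrite (roundedE k x); lra.
Qed.

(* Along the path the nearest terminal changes from t to the last node, and at
   an edge xy where it changes M x + M y >= lambda * N.  The part of the path
   before that edge telescopes forward, the part after it backward. *)
Lemma rounded_path k t x p : near T W t x -> path (@adj G) x p ->
    last x p \in T -> t != last x p ->
  2 * lambda%:Z - rnd N k (m x) <= \sum_(v <- x :: p) rounded k v.
Proof.
elim: p x => [|y p IHp] x tx /=.
  move=> _ xT neq_t; rewrite big_seq1 roundedE.
  have := near_terminal le_T_path tx xT neq_t => leM.
  have: 2 * lambda%:Z <= rnd N k (M x) + rnd N k 0.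
    by apply: rnd_flip; rewrite // addr0 /M; lia.
  have m0 : m x = 0 by rewrite /m /M pot_T // subrr.
  by rewrite m0 rnd0 // addr0 !subr0.
case/andP=> xy yp pT neq_t.
have rx : reachable T x.
  case: tx => tT [A tx _]; apply/existsP; exists t.
  by rewrite tT (linkedS (subsetT A)).
have ry := reachable_adj rx xy; rewrite (big_cons _ _ x).
rewrite (roundedE k x).
have [t' ty] := near_ex W ry.
have [eq_t|neq_t'] := eqVneq t t'.
  rewrite -{}eq_t in ty; have := IHp y ty yp pT neq_t.
  have: rnd N k (m y) <= rnd N k (M x).
    by apply: rnd_le => //; have := pot_adj W rx xy; rewrite /m /M; lia.
  by lra.
have := rounded_path_back k ry yp pT.
have: 2 * lambda%:Z <= rnd N k (M x) + rnd N k (M y).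
  apply: rnd_flip => //; have := near_adj le_T_path tx ty neq_t' xy.
  by rewrite /M; lia.
by lra.
Qed.

Lemma rounded_T_path k x s : T_path T x s ->
  2 * lambda%:Z <= \sum_(v in VP x s) rounded k v.
Proof.
case/and5P=> /andP[xs _] xT yT neq_xy _.
(* A T-path may repeat nodes. A node-simple one inside its node set turns the sum over a set into a
   sum along a list. *)
have [z [s' [zs' us' sub]]] := T_path_linked xT yT neq_xy (linked_walk xs).
case/and5P: zs' => /andP[zs' _] zT yT' neq_zy _.
have h_ge0 v : 0 <= rounded k v by have := rounded_ge k v; lia.
rewrite (big_setID (VP z s')) /= (setIidPr sub) ler_wpDr ?sumr_ge0 //.
have -> : \sum_(v in VP z s') rounded k v
        = \sum_(v <- z :: unzip2 s') rounded k v.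
  by rewrite big_uniq //=; apply: eq_bigl => v; rewrite inE.
have := rounded_path k (near_T W zT) (path_of_walk zs') yT' neq_zy.
by rewrite /m /M pot_T // subrr rnd0 // subr0.
Qed.

End RoundedWeight.

(** * Cost comparison and existence of an optimum *)

Section Assembly.
Local Open Scope ring_scope.
Variables (G : graph) (T : {set VG G}) (c a : VG G -> nat) (lambda : nat).

Definition half (f : VG G -> nat) : VG G -> rat := fun v => (f v)%:R / 2%:R.

Lemma common_denominator (V : finType) (l : V -> rat) : (forall v, 0 <= l v) ->
  exists2 N, (0 < N)%N & exists f : V -> nat, forall v, l v * N%:R = (f v)%:R.
Proof.
move=> l_ge0; pose d v := `|denq (l v)|%N; pose N := (\prod_v d v)%N.
have d_gt0 v : (0 < d v)%N by rewrite absz_gt0 denq_neq0.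
exists N; first by rewrite prodn_gt0.
exists (fun v => (`|numq (l v)| * (N %/ d v))%N) => v.
have /divnK {1}<- : (d v %| N)%N by rewrite /N (bigD1 v) //= dvdn_mulr.
have dE : (d v)%:R = (denq (l v))%:~R :> rat by rewrite -[denq _]absz_denq.
have nE : (`|numq (l v)|%N)%:R = (numq (l v))%:~R :> rat.
  by rewrite -[in RHS](@gez0_abs (numq (l v))) // numq_ge0.
by rewrite !natrM dE nE mulrCA mulrC numqE.
Qed.

Lemma round_feasible l : feasible T a lambda l ->
  exists2 f, feasible T a lambda (half f) & objective c (half f) <= objective c l.
Proof.
case=> l_ge0 lT; have [N N_gt0 [f fE]] := common_denominator l_ge0.
pose W v := (f v + a v * N)%N.
have WE v : (W v)%:R = (l v + (a v)%:R) * N%:R :> rat.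
  by rewrite natrD natrM mulrDl fE.
have le_aW v : (a v * N <= W v)%N by rewrite leq_addl.
have N_gt0r : 0 < N%:R :> rat by rewrite ltr0n.
have WT x s : T_path T x s -> (lambda * N <= \sum_(u in VP x s) W u)%N.
  move=> /lT; rewrite -(ler_nat rat) natrM natr_sum (eq_bigr _ (fun v _ => WE v)).
  rewrite -mulr_suml ler_pM2r // big_split /= /weight /natw.
  by rewrite lerBlDr.
pose C k : int := \sum_v (c v)%:Z * rounded T W N k v.
pose S : int := \sum_v (c v)%:Z * (W v)%:Z.
have sumC : \sum_(k < N) C k = 2 * S.
  rewrite exchange_big mulr_sumr; apply: eq_bigr => v _ /=.
  by rewrite -mulr_sumr sum_rounded // mulrCA.
(* The mean of [N * C k] over [k] is [2 * S], so not every term can reach [2 * S + 1]. *)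
have [k leC] : exists k : 'I_N, N%:Z * C k <= 2 * S.
  apply/existsP; apply: contraT; rewrite negb_exists => /forallP gtC.
  have: \sum_(k < N) (2 * S + 1) <= \sum_(k < N) N%:Z * C k.
    by apply: ler_sum => k _; have := gtC k; lia.
  by rewrite -mulr_sumr sumC sumr_const card_ord -mulr_natl natz; nia.
have ge_a v : (2 * a v)%:Z <= rounded T W N k v by apply: rounded_ge.
(* Back from w to l = w - a, in halves; by [ge_a] the absolute value changes nothing. *)
pose g v := `|rounded T W N k v - (2 * a v)%:Z|%N.
have gE v : half g v = (rounded T W N k v)%:~R / 2 - (a v)%:R.
  rewrite /half (_ : (g v)%:R = (rounded T W N k v - (2 * a v)%:Z)%:~R).
    by rewrite intrB mulrBl -pmulrn natrM mulrAC divff ?mul1r.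
  by rewrite -[in RHS](@gez0_abs (_ - _)) ?subr_ge0.
exists g.
  split=> [v|x s xs]; first by rewrite divr_ge0.
  rewrite {2}/weight (eq_bigr _ (fun v _ => gE v)) sumrB lerD2r.
  rewrite -mulr_suml ler_pdivlMr // mulrC -rmorph_sum /=.
  have := rounded_T_path N_gt0 le_aW WT k xs.
  by rewrite -(ler_int rat) rmorphM.
have -> : objective c (half g) = (C k)%:~R / 2 - \sum_v (c v)%:R * (a v)%:R.
  rewrite /C rmorph_sum mulr_suml -sumrB; apply: eq_bigr => v _.
  by rewrite gE mulrBr mulrA rmorphM.
have -> : objective c l = S%:~R / N%:R - \sum_v (c v)%:R * (a v)%:R.
  rewrite /S rmorph_sum mulr_suml -sumrB; apply: eq_bigr => v _.
  rewrite rmorphM /= -!pmulrn WE mulrA mulfK ?gt_eqF // mulrDr.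
  by rewrite addrK.
rewrite lerD2r ler_pdivrMr // mulrAC ler_pdivlMr // mulrC (mulrC _ 2).
by move: leC; rewrite -(ler_int rat) !rmorphM.
Qed.

Lemma feasible_exists : exists f, feasible T a lambda (half f).
Proof.
(* Every node gets weight [lambda], so the first node of a path already meets the bound. *)
exists (fun=> 2 * lambda)%N; split=> [v|x s _]; first by rewrite divr_ge0.
have halfE v : half (fun=> (2 * lambda)%N) v = lambda%:R.
  by rewrite /half natrM mulrAC divff ?mul1r.
rewrite lerBlDr /weight (eq_bigr _ (fun v _ => halfE v)).
rewrite (bigD1 x) ?inE ?eqxx //= -addrA ler_wpDr //.
by rewrite addr_ge0 // sumr_ge0.
Qed.

Lemma objective_half f :
  objective c (half f) = (\sum_v c v * f v)%N%:R / 2%:R.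
Proof.
rewrite natr_sum mulr_suml; apply: eq_bigr => v _.
by rewrite natrM mulrA.
Qed.

(** Descent on twice the cost, a natural number; feasibility is a [Prop], so deciding whether a
    cheaper point exists is classical. *)
Lemma best_half :
  exists2 f, feasible T a lambda (half f) &
    forall g, feasible T a lambda (half g) ->
      objective c (half f) <= objective c (half g).
Proof.
have [f0 f0T] := feasible_exists.
have [n] := ubnP (\sum_v c v * f0 v)%N; elim: n f0 f0T => // n IHn f fT le_n.
have [[g gT lt_gf]|no_g] := classic (exists2 g, feasible T a lambda (half g) &
  (\sum_v c v * g v < \sum_v c v * f v)%N).
  exact: IHn gT (leq_trans lt_gf le_n).
exists f => // g gT; rewrite !objective_half ler_pM2r ?invr_gt0 // ler_nat leqNgt.
by apply/negP => lt_gf; apply: no_g; exists g.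
Qed.

End Assembly.

Theorem theorem6p1 (G : graph) (T : {set VG G}) (c a : VG G -> nat)
    (lambda : nat) :
  exists l : VG G -> rat, optimal T c a lambda l /\ half_integer l.
Proof.
have [f fT f_min] := best_half T c a lambda.
exists (half f); split; last by move=> v; exists (f v).
split=> // l /(round_feasible c)[g gT le_gl].
exact: Order.POrderTheory.le_trans (f_min g gT) le_gl.
Qed.
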